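(* Fix integers $n\ge2$ and $d\ge2$. The following statements are equivalent. (i) $D_d(n)$ has a decomposition into directed Hamilton cycles. (ii) For every $r\ge1$ and every collection of loopless $n$-vertex digraphs $G_1,\ldots,G_d$, each decomposable into $r$ directed Hamilton cycles, the Cartesian product $G_1\square\cdots\square G_d$ decomposes into $dr$ directed Hamilton cycles. Parallel arcs, if present, are separately labelled.
   Context: $D_d(n)$ is the digraph on $(\mathbb Z/n\mathbb Z)^d$ with arcs $x\to x+e_i$, $1\le i\le d$ (the Cartesian product of $d$ directed $n$-cycles). A decomposition into directed Hamilton cycles is a partition of the arc set into directed spanning cycles. The Cartesian product $G_1\square\cdots\square G_d$ has vertex set $\prod_iV(G_i)$; an arc changes exactly one coordinate, along an arc of the corresponding factor. *)

(* Defs.v *)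
From HB Require Import structures.
From mathcomp Require Import all_boot all_order all_algebra.

Set Implicit Arguments.
Unset Strict Implicit.
Unset Printing Implicit Defensive.

Import GRing.Theory.
Local Open Scope ring_scope.

(* Arcs form a type of their own, so parallel arcs are distinct objects. *)
Record digraph := Digraph {
  vert : finType;
  arc : finType;
  src : arc -> vert;
  tgt : arc -> vert
}.

Definition loopless (G : digraph) : Prop :=
  forall a : arc G, src a != tgt a.

(* [s] lists the arcs in cyclic order; each vertex is the source of exactly
   one of them.  [cycle] also checks the step from the last arc to the first. *)
Definition hamilton_cycle (G : digraph) (H : {set arc G}) : Prop :=
  exists s : seq (arc G),
    [/\ cycle (fun a b : arc G => tgt a == src b) s,
        uniq [seq src a | a <- s],
        (forall v : vert G, v \in [seq src a | a <- s]) &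
        H = [set a in s]].

Definition hamilton_decomposition (G : digraph) (P : {set {set arc G}}) : Prop :=
  partition P [set: arc G] /\ (forall H, H \in P -> hamilton_cycle H).

Definition hamilton_decomposable (G : digraph) : Prop :=
  exists P : {set {set arc G}}, hamilton_decomposition P.

Definition hamilton_decomposable_into (r : nat) (G : digraph) : Prop :=
  exists P : {set {set arc G}}, hamilton_decomposition P /\ #|P| = r.

Section CartesianProduct.
Variables (d : nat) (G : 'I_d -> digraph).

Definition cprod_vert : finType := {dffun forall i : 'I_d, vert (G i)}.

(* An arc leaving [x] is a coordinate [i] together with an arc of [G i]
   leaving [x i]. *)
Definition cprod_arc : finType :=
  {p : cprod_vert * {i : 'I_d & arc (G i)} |
    src (tagged p.2) == p.1 (tag p.2)}.

Definition cprod_src (p : cprod_arc) : cprod_vert := (val p).1.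

Definition cprod_tgt (p : cprod_arc) : cprod_vert :=
  [ffun j => dfwith (val p).1 (tgt (tagged (val p).2)) j].

Definition cartesian_product : digraph := Digraph cprod_src cprod_tgt.

End CartesianProduct.

(* Meant for [1 < n], where ['Z_n] is the ring of integers mod [n]. *)
Definition torus_digraph (d n : nat) : digraph :=
  @Digraph 'rV['Z_n]_d ('rV['Z_n]_d * 'I_d)%type
    (fun a => a.1) (fun a => a.1 + delta_mx 0 a.2).

(* Main.v *)
From mathcomp Require Import all_boot all_order all_algebra.
Require Import Defs.

(** A Hamilton cycle of an [n]-vertex digraph is, as a subgraph, nothing but a
    spanning directed [n]-cycle.  So if [G i] decomposes into Hamilton cycles
    [H_(i,1)], ..., [H_(i,r)], then for each fixed [k] the product of
    [H_(1,k)], ..., [H_(d,k)] is a spanning copy of the torus digraph inside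
    the product of the [G i].  An arc of the product moves one coordinate [i]
    along an arc of [G i], which lies on exactly one [H_(i,k)]; hence these [r]
    torus copies partition the arcs, and decomposing each of them decomposes
    the product.  The number of cycles takes care of itself: the torus has [d]
    arcs for each vertex and a Hamilton cycle has one, so every decomposition
    of the torus consists of [d] cycles.

    For the converse, take [r = 1] and let every [G i] be the directed
    [n]-cycle: the product is then the torus digraph.

    Both directions rest on [hamilton_decomposable_copies], which transports
    decompositions along a family of spanning copies covering every arc once;
    [hamilton_decomposition_param] supplies the [Z_n]-coordinates that define
    the torus copies. *)

Set Implicit Arguments.
Unset Strict Implicit.
Unset Printing Implicit Defensive.

Import GRing.Theory.

(** * Counting and transporting Hamilton cycles *)

Lemma hamilton_cycle_imset (G G' : digraph)
    (psi : vert G -> vert G') (phi : arc G -> arc G') (H : {set arc G}) :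
  bijective psi ->
  (forall a, src (phi a) = psi (src a)) ->
  (forall a, tgt (phi a) = psi (tgt a)) ->
  hamilton_cycle H -> hamilton_cycle (phi @: H).
Proof.
move=> [psi' psiK psi'K] src_phi tgt_phi [s [s_cycle s_uniq s_all ->]].
have srcE : [seq src a | a <- map phi s] = map psi [seq src a | a <- s].
  by rewrite -!map_comp; apply: eq_map => a /=.
exists (map phi s); split.
- rewrite cycle_map; apply: sub_cycle s_cycle => a b /= /eqP tgt_ab.
  by rewrite tgt_phi src_phi tgt_ab.
- by rewrite srcE map_inj_uniq //; apply: can_inj psiK.
- by move=> v; rewrite srcE -[v]psi'K map_f.
- apply/setP=> b; rewrite inE; apply/imsetP/mapP => -[a as_ ->];
    by exists a; rewrite // inE in as_ *.
Qed.

Lemma card_hamilton_cycle (G : digraph) (H : {set arc G}) :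
  hamilton_cycle H -> #|H| = #|vert G|.
Proof.
move=> [s [_ s_uniq s_all ->]].
rewrite cardsE (card_uniqP (map_uniq s_uniq)) -(size_map (@src G)).
by rewrite -(card_uniqP s_uniq); apply: eq_card => v; rewrite s_all.
Qed.

(** Every class of a decomposition has as many arcs as there are vertices, so
    counting arcs leaves only one possible number of classes. *)
Lemma hamilton_decomposition_card (G : digraph) (m : nat) :
  0 < #|vert G| -> #|arc G| = m * #|vert G| ->
  hamilton_decomposable G -> hamilton_decomposable_into m G.
Proof.
move=> vert_gt0 card_arc [P [partP hamP]]; exists P; split=> //.
have := card_uniform_partition
  (fun H HP => card_hamilton_cycle (hamP H HP)) partP.
by rewrite cardsT card_arc => /eqP; rewrite eqn_pmul2r // => /eqP.
Qed.

(** Since every copy of [G] spans [G'], a Hamilton cycle of one copy is a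
    Hamilton cycle of [G'], and since the copies partition the arcs, decomposing
    them separately uses each arc of [G'] once.  A one-point [T] is the case of
    an isomorphism. *)
Lemma hamilton_decomposable_copies (T : finType) (G G' : digraph) (m : nat)
    (psi : T -> vert G -> vert G') (phi : T -> arc G -> arc G') :
  (forall k, bijective (psi k)) ->
  (forall k a, src (phi k a) = psi k (src a)) ->
  (forall k a, tgt (phi k a) = psi k (tgt a)) ->
  injective2 phi ->
  (forall b, exists k a, b = phi k a) ->
  hamilton_decomposable_into m G ->
  hamilton_decomposable_into (#|T| * m) G'.
Proof.
move=> psi_bij src_phi tgt_phi phi_inj phi_onto [P [[partP hamP] cardP]].
have [/eqP coverP trivP P0] := and3P partP.
pose copy (kH : T * {set arc G}) := phi kH.1 @: kH.2.
(* Two classes sharing an arc come from the same copy, by injectivity of [phi],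
   and from the same class of [P]: this gives both disjointness of the classes
   and the count. *)
have copy_meet k k' H H' b : H \in P -> H' \in P ->
    b \in copy (k, H) -> b \in copy (k', H') -> (k, H) = (k', H').
  move=> HP H'P /imsetP[/= a aH ->] /imsetP[/= a' a'H' /phi_inj[-> aa']].
  rewrite -aa' in a'H'.
  by rewrite -(def_pblock trivP HP aH) -(def_pblock trivP H'P a'H').
have copy_n0 k H : H \in P -> exists b, b \in copy (k, H).
  move=> HP; have /set0Pn[a aH] : H != set0 by apply: contraNneq P0 => <-.
  by exists (phi k a); apply: imset_f.
exists (copy @: setX setT P); split; first split.
- apply/and3P; split.
  + apply/eqP/setP=> b; rewrite inE; apply/bigcupP.
    have [k [a ->]] := phi_onto b.
    have aP : a \in cover P by rewrite coverP inE.
    exists (copy (k, pblock P a)); last by apply: imset_f; rewrite mem_pblock.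
    by apply: imset_f; rewrite !inE /= pblock_mem.
  + apply/trivIsetP=> _ _ /imsetP[[k H] + ->] /imsetP[[k' H'] + ->].
    rewrite !inE /= => HP H'P; apply: contraNT => /pred0Pn[b /andP[/= bH bH']].
    by rewrite (copy_meet _ _ _ _ _ HP H'P bH bH').
  + apply/imsetP=> -[[k H] +]; rewrite !inE /= => HP copy0.
    by have [b] := copy_n0 k H HP; rewrite -copy0 inE.
- move=> _ /imsetP[[k H] + ->]; rewrite !inE /= => HP.
  exact: hamilton_cycle_imset (psi_bij k) (src_phi k) (tgt_phi k) (hamP H HP).
- rewrite card_in_imset ?cardsX ?cardsT ?cardP // => -[k H] [k' H'].
  rewrite !inE /= => HP H'P eq_copy; have [b bH] := copy_n0 k H HP.
  by apply: (copy_meet _ _ _ _ b HP H'P bH); rewrite -eq_copy.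
Qed.

(** * Cyclic coordinates on Hamilton cycles *)

(** Indexing the arcs of a Hamilton cycle by their position in its cyclic list
    turns following the cycle into adding [1] in [Z_n], which is how the torus
    digraph moves in one coordinate. *)
Lemma hamilton_cycle_param (n : nat) (G : digraph) (H : {set arc G}) :
  2 <= n -> #|vert G| = n -> hamilton_cycle H ->
  exists g : 'Z_n -> arc G,
    [/\ bijective (fun m => src (g m)),
        (forall m, tgt (g m) = src (g (m + 1)%R)) &
        H = [set g m | m : 'Z_n]].
Proof.
case: n => [|[|n]] // _ cardG hamH.
have cardH : #|H| = n.+2 by rewrite card_hamilton_cycle.
have [s [s_cycle s_uniq s_all defH]] := hamH.
have sz_s : size s = n.+2.
  by rewrite -cardH defH cardsE; apply/esym/card_uniqP/(map_uniq s_uniq).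
case: s => [|a0 s] in s_cycle s_uniq s_all defH sz_s * => //.
pose g (m : 'Z_n.+2) := nth a0 (a0 :: s) m.
have lt_sz (m : 'Z_n.+2) : m < size (a0 :: s) by rewrite sz_s.
exists g; split.
- apply: inj_card_bij; last by rewrite cardG card_ord.
  move=> m m' /eqP; rewrite /g -!(nth_map _ (src a0)) //.
  by rewrite nth_uniq ?size_map // => /eqP/val_inj.
- move=> m; have /(pathP a0)/(_ (m : nat)) := s_cycle.
  rewrite size_rcons => /(_ (lt_sz m)); rewrite -rcons_cons nth_rcons lt_sz.
  move=> /eqP tgt_m; rewrite [LHS]tgt_m /g nth_rcons.
  have -> : (m + 1)%R = m.+1 %% n.+2 :> nat by rewrite /= modnDmr addn1.
  have sz_s' : size s = n.+1 by case: sz_s.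
  (* Only the last position wraps around to the head [a0] of the list. *)
  have := ltn_ord m; rewrite ltnS leq_eqVlt => /orP[/eqP /= m_max|/= m_lt].
    by rewrite sz_s' m_max ltnn eqxx modnn.
  by rewrite sz_s' m_lt modn_small.
- apply/setP=> a; rewrite defH inE; apply/idP/imsetP=> [a_s|[m _ ->]].
    have lt_ai : index a (a0 :: s) < n.+2 by rewrite -sz_s index_mem.
    by exists (Ordinal lt_ai) => //; rewrite /g /= nth_index.
  exact: mem_nth.
Qed.

(** Each arc has unique coordinates: the index [k] of the class containing it
    and its position [m] on that cycle. *)
Lemma hamilton_decomposition_param (n r : nat) (G : digraph) :
  2 <= n -> #|vert G| = n -> hamilton_decomposable_into r G ->
  exists g : 'I_r -> 'Z_n -> arc G,
    [/\ (forall k, bijective (fun m => src (g k m))),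
        (forall k m, tgt (g k m) = src (g k (m + 1)%R)),
        injective2 g &
        forall a, exists k m, a = g k m].
Proof.
move=> hn cardG [P [[partP hamP] cardP]]; subst r.
have [/eqP coverP trivP P0] := and3P partP.
have /fin_all_exists[g gP] (k : 'I_#|P|) :=
  hamilton_cycle_param hn cardG (hamP _ (enum_valP k)).
exists g; split=> [k|k m|k k' m m' eq_g|a].
- by have [] := gP k.
- by have [] := gP k.
- have g_in j l : g j l \in enum_val j by have [_ _ ->] := gP j; apply: imset_f.
  have gk' : g k m \in enum_val k' by rewrite eq_g.
  have eq_k : k = k'.
    apply: enum_val_inj; rewrite -(def_pblock trivP (enum_valP k) (g_in k m)).
    by rewrite -(def_pblock trivP (enum_valP k') gk').
  subst k'; have [src_bij _ _] := gP k.
  by split=> //; apply: (bij_inj src_bij); rewrite eq_g.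
- have aP : a \in cover P by rewrite coverP inE.
  have BP := pblock_mem aP; pose k := enum_rank_in BP (pblock P a).
  have [_ _ defB] := gP k; exists k.
  have /imsetP[m _ ->] : a \in [set g k m | m : 'Z_n].
    by rewrite -defB enum_rankK_in // mem_pblock.
  by exists m.
Qed.

(** * Torus copies in a Cartesian product *)

Lemma torus_hamilton_decomposable_into (d n : nat) :
  hamilton_decomposable (torus_digraph d n) ->
  hamilton_decomposable_into d (torus_digraph d n).
Proof.
apply: hamilton_decomposition_card; first by apply/card_gt0P; exists 0%R.
by rewrite card_prod card_ord mulnC.
Qed.

Section TorusCopies.
Variables (d n r : nat) (G : 'I_d -> digraph).
Variable g : forall i, 'I_r -> 'Z_n -> arc (G i).

(** The copy of the torus spanned by the [k]-th cycles of all the factors: the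
    coordinate [x i] is read as a position on the [k]-th cycle of [G i]. *)
Definition torus_copy_vert (k : 'I_r) (x : vert (torus_digraph d n)) :
    vert (cartesian_product G) :=
  [ffun i => src (g i k (x 0%R i))].

Lemma torus_copy_arc_subproof k (a : arc (torus_digraph d n)) :
  src (g a.2 k (a.1 0%R a.2)) == torus_copy_vert k a.1 a.2.
Proof. by rewrite ffunE. Qed.

Definition torus_copy_arc (k : 'I_r) (a : arc (torus_digraph d n)) :
    arc (cartesian_product G) :=
  exist _ (torus_copy_vert k a.1,
           Tagged (fun i => arc (G i)) (g a.2 k (a.1 0%R a.2)))
    (torus_copy_arc_subproof k a).

End TorusCopies.

(** The copies are arc-disjoint because the arc of [G i] along which an arc of
    the product moves determines [k]; they cover every arc because that arc of
    [G i] lies on some [k]-th cycle, and the vertices of the [k]-th copy are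
    all the vertices of the product. *)
Lemma cartesian_product_hamilton (d n r : nat) (G : 'I_d -> digraph) :
  2 <= n ->
  (forall i, #|vert (G i)| = n) ->
  (forall i, hamilton_decomposable_into r (G i)) ->
  hamilton_decomposable (torus_digraph d n) ->
  hamilton_decomposable_into (d * r) (cartesian_product G).
Proof.
move=> hn cardG decG decT.
have /fin_all_exists[g gP] i :=
  hamilton_decomposition_param hn (cardG i) (decG i).
have src_bij i k : bijective (fun m => src (g i k m)) by have [] := gP i.
have src_inj i k := bij_inj (src_bij i k).
have vert_inj k : injective (torus_copy_vert g k).
  move=> x y /ffunP eq_xy; apply/rowP=> i.
  by have := eq_xy i; rewrite !ffunE => /src_inj.
have vert_bij k : bijective (torus_copy_vert g k).
  have /fin_all_exists[h hK] i : exists h : vert (G i) -> 'Z_n,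
      cancel h (fun m => src (g i k m)).
    by have [h _ hK] := src_bij i k; exists h.
  pose inv (y : vert (cartesian_product G)) : vert (torus_digraph d n) :=
    (\row_i h i (y i))%R.
  have invK : cancel inv (torus_copy_vert g k).
    by move=> y; apply/ffunP=> i; rewrite ffunE mxE hK.
  by exists inv => // x; apply: (vert_inj k); exact: invK.
rewrite mulnC -[r]card_ord.
apply: (@hamilton_decomposable_copies _ (torus_digraph d n) _ d
  (torus_copy_vert g) (torus_copy_arc g)) => //.
- move=> k [x i]; have [_ tgt_g _ _] := gP i.
  apply/ffunP=> j; rewrite !ffunE /= !mxE eqxx /=.
  case: (eqVneq j i) => [->|ji]; first by rewrite dfwith_in tgt_g.
  by rewrite dfwith_out 1?eq_sym // addr0 ffunE.
(* The arcs of the factor agree, which forces [k = k']; then equal sources in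
   the same copy force equal torus vertices. *)
- move=> k k' [x i] [y j] /(congr1 val) eq_val.
  have eq_vert : torus_copy_vert g k x = torus_copy_vert g k' y.
    by have := congr1 (fun p => p.1) eq_val.
  have eq_arc := congr1 (fun p => p.2) eq_val.
  have eq_ij : i = j := congr1 tag eq_arc.
  subst j; have [_ _ g_inj _] := gP i.
  have /g_inj[eq_k _] : g i k (x 0%R i) = g i k' (y 0%R i).
    by move/eqP: eq_arc; rewrite /= eq_Tagged /= => /eqP.
  by subst k'; rewrite (vert_inj k x y).
- move=> [[y [i a]] ya]; have [_ _ _ g_onto] := gP i.
  have [k [m def_a]] := g_onto a; subst a.
  have [inv _ invK] := vert_bij k; exists k, (inv y, i).
  have inv_y : (inv y) 0%R i = m.
    by apply: (src_inj i k); have /ffunP/(_ i) := invK y;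
      rewrite ffunE (eqP ya).
  by apply: val_inj; rewrite /= inv_y invK.
- exact: torus_hamilton_decomposable_into.
Qed.

(** * The torus as a product of directed cycles *)

Definition directed_cycle (n : nat) : digraph :=
  @Digraph 'Z_n 'Z_n id (fun m => m + 1)%R.

Lemma directed_cycle_hamilton_decomposable_into (n : nat) :
  hamilton_decomposable_into 1 (directed_cycle n).
Proof.
apply: hamilton_decomposition_card; rewrite ?mul1n //.
  by apply/card_gt0P; exists (0%R : 'Z_n).
exists [set setT]; split.
  apply/and3P; split; first by rewrite cover1.
    exact: trivIset1.
  by rewrite inE eq_sym -card_gt0 cardsT; apply/card_gt0P; exists (0%R : 'Z_n).
move=> _ /set1P->; pose s := orbit (fun m : 'Z_n => (m + 1)%R) 0%R.
have s_all v : v \in s.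
  have iter_nat k : iter k (fun m : 'Z_n => (m + 1)%R) 0%R = (k%:R)%R.
    by elim: k => //= k ->; rewrite natr1.
  by rewrite -fconnect_orbit -[v]natr_Zp -iter_nat fconnect_iter.
exists s; rewrite map_id; split=> //.
- by apply: cycle_orbit; apply: addIr.
- exact: orbit_uniq.
- by apply/setP=> v; rewrite !inE s_all.
Qed.

(** The product of directed cycles is the torus digraph, except that a vertex
    is a finite function instead of a row vector, and that an arc of the
    product also records the arc of the factor, which its source and coordinate
    determine. *)
Lemma torus_of_directed_cycles (d n : nat) :
  hamilton_decomposable_into d
    (cartesian_product (fun _ : 'I_d => directed_cycle n)) ->
  hamilton_decomposable (torus_digraph d n).
Proof.
set G := cartesian_product _ => decG.
pose psi (x : vert G) : vert (torus_digraph d n) := (\row_i x i)%R.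
pose phi (a : arc G) : arc (torus_digraph d n) :=
  (psi (src a), tag (val a).2).
have psi_bij : bijective psi.
  exists (fun y : vert (torus_digraph d n) => [ffun i => y 0%R i] : vert G).
    by move=> x; apply/ffunP=> i; rewrite ffunE mxE.
  by move=> y; apply/rowP=> i; rewrite mxE ffunE.
suff [P [decP _]] :
    hamilton_decomposable_into (#|{: unit}| * d) (torus_digraph d n).
  by exists P.
apply: (@hamilton_decomposable_copies _ G _ d (fun=> psi) (fun=> phi)) => //.
- move=> _ [[x [i a]] ax]; have def_a : a = x i := eqP ax.
  apply/rowP=> j; rewrite !mxE eqxx /= ffunE /cprod_src /=.
  case: (eqVneq j i) => [->|ji]; first by rewrite dfwith_in def_a.
  by rewrite dfwith_out 1?eq_sym // addr0.
- move=> [] [] [[x [i a]] ax] [[y [j b]] bx] [/(bij_inj psi_bij) eq_xy eq_ij].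
  rewrite /= /cprod_src /= in eq_xy eq_ij; split=> //; apply: val_inj => /=.
  by have := eqP ax; have := eqP bx; rewrite /= eq_xy eq_ij => -> ->.
- move=> [y i]; have [inv _ invK] := psi_bij.
  pose u : {i : 'I_d & arc (directed_cycle n)} := existT _ i (inv y i).
  have u_src : src (tagged u) == inv y (tag u) by [].
  exists tt, (exist _ (inv y, u) u_src).
  by rewrite /phi /= /cprod_src /= invK.
Qed.

Theorem proposition10p1 (n d : nat) (hn : 2 <= n) (hd : 2 <= d) :
  hamilton_decomposable (torus_digraph d n) <->
  (forall (r : nat) (G : 'I_d -> digraph),
     1 <= r ->
     (forall i : 'I_d,
        [/\ loopless (G i), #|vert (G i)| = n &
            hamilton_decomposable_into r (G i)]) ->
     hamilton_decomposable_into (d * r) (cartesian_product G)).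
Proof.
split=> [decT r G _ decG|decG].
  by apply: cartesian_product_hamilton decT => // i; have [] := decG i.
apply: torus_of_directed_cycles.
rewrite -[X in hamilton_decomposable_into X]muln1.
apply: decG => // i; split.
(* No loops: [m = m + 1] would mean [1 = 0] in [Z_n]. *)
- move=> m; rewrite /= -subr_eq0 opprD addrA subrr sub0r oppr_eq0.
  exact: oner_neq0.
- by rewrite card_ord Zp_cast.
- exact: directed_cycle_hamilton_decomposable_into.
Qed.
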